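(* An epr-sequence starting with $\mathtt{S}$ is attainable by a symmetric matrix over $\mathbb{Z}_2$ if and only if it has one of the following forms: 1. $\mathtt{S}\overline{\mathtt{S}}\mathtt{N}\overline{\mathtt{N}}$; 2. $\mathtt{S}\overline{\mathtt{S}}\mathtt{A}$; 3. $\mathtt{S}\overline{\mathtt{S}}\mathtt{AA}$; 4. $\mathtt{SS}\overline{\mathtt{S}}\mathtt{AN}$; 5. $\mathtt{SASA}\overline{\mathtt{SA}}$; 6. $\mathtt{SASA}\overline{\mathtt{SA}}\mathtt{A}$; 7. $\mathtt{SA}\overline{\mathtt{SA}}\mathtt{N}$.
   Context: $\mathbb{Z}_2$ is the field of integers modulo $2$. For an $n\times n$ symmetric matrix $B$ over a field $\mathbb{F}$, the enhanced principal rank characteristic sequence (epr-sequence) is $\operatorname{epr}(B)=\ell_1\ell_2\cdots\ell_n$, where $\ell_k=\mathtt{A}$ if all principal minors of $B$ of order $k$ are nonzero, $\ell_k=\mathtt{S}$ if some but not all principal minors of order $k$ are nonzero, and $\ell_k=\mathtt{N}$ if all principal minors of order $k$ are zero. A finite nonempty sequence over $\{\mathtt{A},\mathtt{S},\mathtt{N}\}$ is attainable over $\mathbb{F}$ if it equals $\operatorname{epr}(B)$ for some symmetric matrix $B$ over $\mathbb{F}$; its order is its length. In a form, an overlined block $\overline{t_1\cdots t_k}$ stands for the block $t_1\cdots t_k$ repeated any number of times $\geq 0$ (so it may be omitted entirely); a sequence ''has a form'' if it is obtained by some choice of the repetition numbers, chosen independently for each overlined block. *)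

(* Defs.v *)
From mathcomp Require Import all_boot all_order all_algebra.
Set Implicit Arguments.
Unset Strict Implicit.
Unset Printing Implicit Defensive.
Import GRing.Theory.
Local Open Scope ring_scope.

Inductive epr_letter : Type := LA | LS | LN.

Section Epr.

Variable F : fieldType.

(* [enum_val] lists the elements of [alpha] in increasing order, so the
   submatrix keeps the row and column order of [B]. *)
Definition principal_submx (n : nat) (B : 'M[F]_n) (alpha : {set 'I_n}) :
    'M[F]_#|alpha| :=
  mxsub (fun i : 'I_#|alpha| => enum_val i)
        (fun j : 'I_#|alpha| => enum_val j) B.

Definition principal_minor (n : nat) (B : 'M[F]_n) (alpha : {set 'I_n}) : F :=
  \det (principal_submx B alpha).

(* Only used with [1 <= k <= n]: principal minors of order [k] then exist, so
   the first two tests are mutually exclusive. *)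
Definition epr_entry (n : nat) (B : 'M[F]_n) (k : nat) : epr_letter :=
  if [forall alpha : {set 'I_n},
        (#|alpha| == k) ==> (principal_minor B alpha != 0)] then LA
  else if [forall alpha : {set 'I_n},
        (#|alpha| == k) ==> (principal_minor B alpha == 0)] then LN
  else LS.

Definition epr (n : nat) (B : 'M[F]_n) : seq epr_letter :=
  [seq epr_entry B k | k <- iota 1 n].

Definition attainable (s : seq epr_letter) : Prop :=
  exists (n : nat) (B : 'M[F]_n), [/\ (0 < n)%N, B^T = B & epr B = s].

End Epr.

Definition rep (k : nat) (t : seq epr_letter) : seq epr_letter :=
  flatten (nseq k t).

(* Main.v *)
Require Import Defs.
From mathcomp Require Import all_boot all_order all_algebra.
From mathcomp Require Import zify.
Set Implicit Arguments.
Unset Strict Implicit.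
Unset Printing Implicit Defensive.
Import GRing.Theory.
Local Open Scope ring_scope.

(* Write [nonsingular] for a set of indices whose principal minor is nonzero.
   In characteristic 2 the principal pivot transform of B at a nonsingular set
   [alpha] is a symmetric matrix P such that [beta] is nonsingular for P iff the
   symmetric difference of [alpha] and [beta] is nonsingular for B.
   - If the k-th letter is N but some set of order k+1 is nonsingular, the pivot
     at this set has zero diagonal, hence so has B: after an initial S, a letter
     N is followed only by N.
   - If the k-th letter is A with 3 <= k <= n-2, pivoting at a set of order k and
     looking at one more pair of indices shows that all sets of order k+2 are
     nonsingular. The pivot P at such a set [gamma] has only nonsingular pairs in
     [gamma], that is, P = p p^T + 1 1^T + I on [gamma], with p the diagonal of P,
     and all even subsets of [gamma] are nonsingular for P. So all sets of order
     at most k+2 with the parity of k are nonsingular for B: if k is odd the first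
     letter is A, and if k is even the second one is.
   - If the second letter is A, then B = p p^T + 1 1^T + I, a family whose
     sequences are computed directly. *)

(** * Singularity through kernel vectors, and the principal pivot transform *)

Definition singular_on (F : fieldType) (n : nat) (B : 'M[F]_n)
    (alpha : {set 'I_n}) : Prop :=
  exists x : 'rV[F]_n,
    [/\ x != 0, forall i, i \notin alpha -> x 0 i = 0
      & forall i, i \in alpha -> (x *m B) 0 i = 0].

Definition symdiff (T : finType) (A B : {set T}) : {set T} :=
  [set x | (x \in A) (+) (x \in B)].

Section PrincipalMinors.

Variable F : fieldType.
Implicit Types (n : nat).

Lemma mulmx_supported n (B : 'M[F]_n) (alpha : {set 'I_n}) (x : 'rV_n) i :
    (forall i, i \notin alpha -> x 0 i = 0) ->
  (x *m B) 0 i = \sum_(j in alpha) x 0 j * B j i.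
Proof.
move=> xs; rewrite mxE (bigID (mem alpha)) /= [X in _ + X]big1 ?addr0 //.
by move=> j ja; rewrite xs ?mul0r.
Qed.

(** A kernel vector of the submatrix extends by zero outside [alpha], and one supported on [alpha]
    restricts. Vectors of full length keep the reindexing by [enum_val] out of all later
    arguments. *)
Lemma principal_minor_eq0P n (B : 'M[F]_n) (alpha : {set 'I_n}) :
  reflect (singular_on B alpha) (principal_minor B alpha == 0).
Proof.
apply: (iffP det0P) => [[v v0 vB]|[x [x0 xs xB]]].
- pose x := \row_j \sum_(i < #|alpha|) v 0 i *+ (enum_val i == j).
  have xE k : x 0 (enum_val k) = v 0 k.
    rewrite mxE (bigD1 k) //= eqxx big1 ?addr0 // => i ik.
    by rewrite (inj_eq enum_val_inj) (negPf ik).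
  have xs i : i \notin alpha -> x 0 i = 0.
    move=> ia; rewrite mxE big1 // => k _; case: eqP => // ki.
    by move: ia; rewrite -ki enum_valP.
  exists x; split=> //.
  + apply: contra v0 => /eqP x0; apply/eqP/rowP => k.
    by rewrite -xE x0 !mxE.
  + move=> i ia; pose k := enum_rank_in ia i.
    have ik : enum_val k = i by rewrite enum_rankK_in.
    have := congr1 (fun w : 'rV_ _ => w 0 k) vB; rewrite mxE [RHS]mxE => <-.
    rewrite (mulmx_supported B i xs).
    by rewrite big_enum_val /=; apply: eq_bigr => j _; rewrite xE !mxE ik.
- exists (\row_k x 0 (enum_val k)).
  + apply: contra x0 => /eqP v0; apply/eqP/rowP => i; rewrite mxE.
    have [ia|/xs//] := boolP (i \in alpha).
    have := congr1 (fun w : 'rV_ _ => w 0 (enum_rank_in ia i)) v0.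
    by rewrite !mxE enum_rankK_in.
  + apply/rowP => k; rewrite mxE [RHS]mxE -[RHS](xB (enum_val k)) ?enum_valP //.
    rewrite (mulmx_supported B _ xs) [RHS]big_enum_val /=.
    by apply: eq_bigr => j _; rewrite !mxE.
Qed.

Lemma principal_minor_ker n (B : 'M[F]_n) (alpha : {set 'I_n}) (x : 'rV_n) :
    principal_minor B alpha != 0 ->
    (forall i, i \notin alpha -> x 0 i = 0) ->
    (forall i, i \in alpha -> (x *m B) 0 i = 0) -> x = 0.
Proof.
move=> ma xs xB; apply/eqP; apply: contraNT ma => x0.
by apply/principal_minor_eq0P; exists x.
Qed.

Lemma principal_minor_set0 n (B : 'M[F]_n) : principal_minor B set0 != 0.
Proof.
apply/principal_minor_eq0P => -[x [x0 xs _]]; case/eqP: x0.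
by apply/rowP => i; rewrite xs ?inE // mxE.
Qed.

Lemma principal_minor_set1 n (B : 'M[F]_n) i :
  (principal_minor B [set i] == 0) = (B i i == 0).
Proof.
apply/principal_minor_eq0P/eqP => [[x [x0 xs xB]]|Bii].
- have := xB i (set11 i); rewrite (mulmx_supported _ _ xs) big_set1.
  move=> /eqP; rewrite mulf_eq0 => /orP[/eqP xi|/eqP//].
  case/eqP: x0; apply/rowP => j; rewrite mxE.
  by have [->//|ji] := eqVneq j i; rewrite xs // inE.
- exists (delta_mx 0 i); split.
  + by apply/eqP => /rowP/(_ i)/eqP; rewrite !mxE !eqxx oner_eq0.
  + by move=> j; rewrite inE mxE eqxx => /negPf->.
  + by move=> j /set1P->; rewrite -rowE mxE.
Qed.

(** The terms at (i, j) and (j, i) agree by symmetry and cancel in characteristic 2; the diagonal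
    terms vanish. *)
Lemma alternating_form_eq0 n (P : 'M[F]_n) (u : 'rV_n) :
    2 \in [pchar F] -> P^T = P -> (forall i, P i i = 0) ->
  \sum_i (u *m P) 0 i * u 0 i = 0.
Proof.
move=> F2 PT Pd; pose a i j := u 0 j * P j i * u 0 i.
have aC i j : a i j = a j i.
  by rewrite /a -[in P j i]PT mxE mulrAC mulrC mulrA mulrAC -mulrA mulrCA mulrA.
rewrite (eq_bigr (fun i => \sum_j a i j)); last first.
  by move=> i _; rewrite mxE mulr_suml.
rewrite (eq_bigr (fun i : 'I_n => \sum_(j : 'I_n | (j < i)%N) a i j
                           + \sum_(j : 'I_n | (i < j)%N) a i j)); last first.
  move=> i _; rewrite (bigID (fun j : 'I_n => (j < i)%N)) /=; congr (_ + _).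
  rewrite (bigD1 i) ?ltnn //= {1}/a Pd mulr0 mul0r add0r.
  by apply: eq_bigl => j; rewrite -leqNgt ltn_neqAle andbC eq_sym.
rewrite big_split /= [X in _ + X](exchange_big_dep predT) //=.
rewrite [X in _ + X](eq_bigr (fun i : 'I_n => \sum_(j : 'I_n | (j < i)%N) a i j)).
  by rewrite -mulr2n -mulr_natr (pcharf0 F2) mulr0.
by move=> i _; apply: eq_bigr => j _; rewrite aC.
Qed.

(* Principal pivot transform: exchanging the coordinates in alpha between
   x and y = x B turns the graph of B into the graph of P. *)
Lemma principal_pivot n (B : 'M[F]_n) (alpha : {set 'I_n}) :
    2 \in [pchar F] -> B^T = B -> principal_minor B alpha != 0 ->
  exists P : 'M[F]_n, [/\ P^T = P,
    forall beta, (principal_minor P beta == 0)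
                 = (principal_minor B (symdiff alpha beta) == 0)
    & (forall i, P i i = 0) -> forall i, B i i = 0].
Proof.
move=> F2 BT ma.
(* [D] projects onto [alpha]. With y = x B, the vector x T has the entries of y on [alpha] and those
   of x elsewhere, and x W the other way round; so P has to be the inverse of T times W. *)
pose D : 'M[F]_n := diag_mx (\row_i (i \in alpha)%:R).
pose T := (1%:M - D) + B *m D; pose W := D + B *m (1%:M - D).
have xD (x : 'rV_n) i : (x *m D) 0 i = if i \in alpha then x 0 i else 0.
  by rewrite mul_mx_diag !mxE; case: ifP; rewrite ?mulr1 ?mulr0.
have xT (x : 'rV_n) i :
    (x *m T) 0 i = if i \in alpha then (x *m B) 0 i else x 0 i.
  rewrite mulmxDr mulmxBr mulmx1 mulmxA [LHS]mxE [X in X + _]mxE.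
  by rewrite [X in _ + X + _]mxE !xD; case: ifP; rewrite ?subrr ?add0r ?subr0 ?addr0.
have xW (x : 'rV_n) i :
    (x *m W) 0 i = if i \in alpha then x 0 i else (x *m B) 0 i.
  rewrite mulmxDr mulmxA mulmxBr mulmx1 [LHS]mxE [X in _ + X]mxE.
  by rewrite [X in _ + (_ + X)]mxE !xD; case: ifP;
    rewrite ?subrr ?addr0 ?subr0 ?add0r.
(* A row vector killed by [T] vanishes outside [alpha] and is sent by [B] to zero on [alpha], so it
   is zero because [alpha] is nonsingular. *)
have Tu : T \in unitmx.
  rewrite -row_free_unit -kermx_eq0; apply/eqP/row_matrixP => k.
  rewrite row0; apply: (principal_minor_ker ma) => i ia;
    have /rowP/(_ i) : row k (kermx T) *m T = 0 by rewrite -row_mul mulmx_ker row0.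
  + by rewrite xT (negPf ia) [RHS]mxE.
  + by rewrite xT ia [RHS]mxE.
pose P := invmx T *m W.
have TP : T *m P = W by rewrite mulKVmx.
have DT : D^T = D by rewrite tr_diag_mx.
have DD : D *m D = D.
  apply/matrixP => i j; rewrite mul_mx_diag !mxE.
  by case: eqP => [->|]; rewrite ?mul0r //; case: (_ \in _); rewrite ?mulr1 ?mulr0.
have DE : D *m (1%:M - D) = 0 by rewrite mulmxBr mulmx1 DD subrr.
have ED : (1%:M - D) *m D = 0 by rewrite mulmxBl mul1mx DD subrr.
have EE : (1%:M - D) *m (1%:M - D) = 1%:M - D.
  by rewrite [LHS]mulmxBr ED mulmx1 subr0.
have ET : (1%:M - D)^T = 1%:M - D by rewrite linearB /= trmx1 DT.
have TT : T^T = (1%:M - D) + D *m B.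
  by rewrite /T [LHS]linearD /= trmx_mul BT DT ET.
have WT : W *m T^T = D *m B + B *m (1%:M - D).
  rewrite TT /W; move: (1%:M - D) DE ED EE => E DE ED EE.
  rewrite mulmxDl !mulmxDr DE mulmxA DD add0r -!mulmxA EE.
  by rewrite [E *m (D *m B)]mulmxA ED mul0mx mulmx0 addr0.
(* As T is invertible, symmetry of T P T^T suffices. It equals D B + B - B D, its transpose is B D +
   B - D B, and signs do not matter in characteristic 2. *)
have PT : P^T = P.
  have TPT : T *m P *m T^T = D *m B + B *m (1%:M - D) by rewrite TP.
  have : (T *m P *m T^T)^T = T *m P *m T^T.
    rewrite TPT [LHS]linearD /= !trmx_mul ET BT DT.
    rewrite mulmxBl mulmxBr mul1mx mulmx1.
    move: (B *m D) (D *m B) => X Y.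
    apply/matrixP => i j; rewrite !mxE !(oppr_pchar2 F2).
    by rewrite addrCA [RHS]addrCA [Y i j + _]addrC.
  rewrite !trmx_mul trmxK mulmxA.
  move=> /(can_inj (mulmxK (etrans (unitmx_tr T) Tu))).
  by move=> /(can_inj (mulKmx Tu)).
exists P; split=> // [beta|Pd i].
(* With u = x T, the exchange of coordinates turns the kernel conditions for P on [beta] into those
   for B on the symmetric difference. *)
- have uw (x : 'rV_n) i : (x *m T *m P) 0 i = if i \in alpha then x 0 i else (x *m B) 0 i.
    by rewrite -mulmxA TP xW.
  apply/principal_minor_eq0P/principal_minor_eq0P => -[u [u0 us uP]].
  + exists (u *m invmx T); set x := u *m _.
    have uE : u = x *m T by rewrite mulmxKV.
    split=> [|i|i]; first by apply: contra u0 => /eqP x0; rewrite uE x0 mul0mx.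
    * rewrite inE negb_add => /eqP ab.
      have [ib|ib] := boolP (i \in beta).
        by have := uP i ib; rewrite uE uw ab ib.
      by have := us i ib; rewrite uE xT ab (negPf ib).
    * rewrite inE => ab; have [ib|ib] := boolP (i \in beta).
        by move: ab (uP i ib); rewrite ib uE uw; case: ifP.
      by move: ab (us i ib); rewrite (negPf ib) uE xT; case: ifP.
  + exists (u *m T); split=> [|i ib|i ib].
    * apply: contra u0 => /eqP uT; apply/eqP.
      by rewrite -[u](mulmxK Tu) uT mul0mx.
    * rewrite xT; case: ifP => ia; first by apply: uP; rewrite inE ia (negPf ib).
      by apply: us; rewrite inE ia (negPf ib).
    * rewrite uw; case: ifP => ia; first by apply: us; rewrite inE ia ib.
      by apply: uP; rewrite inE ia ib.
(* At each index the exchange at most swaps the two factors, so the form of P at x T equals the form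
   of B at x. The former is zero, and at a unit vector the latter is [B i i]. *)
- pose x : 'rV[F]_n := delta_mx 0 i.
  have := alternating_form_eq0 (x *m T) F2 PT Pd.
  rewrite (eq_bigr (fun j => (x *m B) 0 j * x 0 j)); last first.
    move=> j _; rewrite -mulmxA TP xT xW; case: ifP => // _; exact: mulrC.
  rewrite (bigD1 i) //= big1 => [|j ji]; last first.
    by rewrite [x 0 j]mxE (negPf ji) mulr0.
  by rewrite addr0 -rowE !mxE !eqxx mulr1.
Qed.

End PrincipalMinors.

(** * Index sets of given size, and the meaning of each letter *)

Lemma exists_card_between (T : finType) (A C : {set T}) k :
    A \subset C -> (#|A| <= k <= #|C|)%N ->
  exists B : {set T}, [/\ A \subset B, B \subset C & #|B| = k].
Proof.
move=> AC /andP[]; elim: k => [|k IHk].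
  by rewrite leqn0 cards_eq0 => /eqP A0 _; exists A; rewrite A0 cards0 !sub0set.
rewrite leq_eqVlt => /predU1P[Ak _|Ak kC]; first by exists A.
have [B [AB BC Bk]] := IHk Ak (ltnW kC).
have /properP[_ [x xC xB]] : B \proper C by rewrite properEcard BC Bk.
exists (x |: B); split; last by rewrite cardsU1 xB Bk.
- exact: subset_trans AB (subsetUr _ _).
- by rewrite subUset sub1set xC.
Qed.

Lemma card_full n (alpha : {set 'I_n}) : #|alpha| = n -> alpha = setT.
Proof.
by move=> an; apply/eqP; rewrite eqEcard subsetT cardsT card_ord an leqnn.
Qed.

Section EprEntry.

Variables (F : fieldType) (n : nat) (B : 'M[F]_n) (k : nat).

Lemma epr_entryA :
  epr_entry B k = LA <->
  forall alpha : {set 'I_n}, #|alpha| = k -> principal_minor B alpha != 0.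
Proof.
rewrite /epr_entry; case: ifP => [/'forall_implyP|/negP] H.
  by split=> // _ alpha /eqP; apply: H.
split=> [|mB]; first by case: ifP.
by case: H; apply/'forall_implyP => alpha /eqP; apply: mB.
Qed.

Hypothesis kn : (k <= n)%N.

Lemma epr_entryN :
  epr_entry B k = LN <->
  forall alpha : {set 'I_n}, #|alpha| = k -> principal_minor B alpha = 0.
Proof.
(* A set of order [k] exists, so the first test of [epr_entry] fails when all minors vanish. *)
have [alpha [_ _ ak]] : exists alpha : {set 'I_n},
    [/\ set0 \subset alpha, alpha \subset setT & #|alpha| = k].
  by apply: exists_card_between; rewrite ?sub0set // cards0 cardsT card_ord.
rewrite /epr_entry; case: ifP => [/'forall_implyP H|_].
  split=> // mB; have := H alpha; rewrite ak eqxx mB // eqxx.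
  by move=> /(_ isT).
case: ifP => [/'forall_implyP H'|/negP H'].
  by split=> // _ beta /eqP bk; apply/eqP/H'.
split=> // mB; case: H'.
by apply/'forall_implyP => beta /eqP bk; apply/eqP/mB.
Qed.

Lemma epr_entryS :
  epr_entry B k = LS <->
  (exists alpha : {set 'I_n}, #|alpha| = k /\ principal_minor B alpha = 0) /\
  (exists alpha : {set 'I_n}, #|alpha| = k /\ principal_minor B alpha != 0).
Proof.
split=> [eS|[[a [ak a0]] [b [bk b0]]]].
- split.
  + have : ~ epr_entry B k = LA by rewrite eS.
    rewrite /epr_entry; case: ifP => // /negbT.
    rewrite negb_forall => /existsP[a]; rewrite negb_imply negbK.
    by case/andP => /eqP ak /eqP a0 _; exists a.
  + have : ~ epr_entry B k = LN by rewrite eS.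
    move: eS; rewrite /epr_entry; case: ifP => //; case: ifP => // /negbT.
    rewrite negb_forall => /existsP[a]; rewrite negb_imply.
    by case/andP => /eqP ak a0 _ _; exists a.
- case e : (epr_entry B k) => //.
  + by move/epr_entryA: e => /(_ a ak); rewrite a0 eqxx.
  + by move/epr_entryN: e => /(_ b bk) bz; rewrite bz eqxx in b0.
Qed.

End EprEntry.

(** * Small minors and pairwise nonsingular sets over $\mathbb{Z}_2$ *)

Lemma F2_cases (x : 'F_2) : x = 0 \/ x = 1.
Proof. by case: x => -[|[|//]] ?; [left|right]; apply/val_inj. Qed.

Lemma F2_pchar : 2 \in [pchar 'F_2].
Proof. exact: pchar_Fp. Qed.

Lemma F2_neq0 (x : 'F_2) : (x != 0) = (x == 1).
Proof. by case: (F2_cases x) => ->. Qed.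

(** Squaring is the identity on $\mathbb{Z}_2$, so the determinant is the product of the two
    diagonal entries plus [B i j], and nonzero means equal to 1. *)
Lemma principal_minor_pair n (B : 'M['F_2]_n) i j :
    B^T = B -> i != j -> principal_minor B [set i; j] != 0 ->
  B i j = B i i * B j j + 1.
Proof.
move=> BT ij mB; have Bji : B j i = B i j by rewrite -[in LHS]BT mxE.
pose x a c : 'rV['F_2]_n := a *: delta_mx 0 i + c *: delta_mx 0 j.
have xs a c k : k \notin [set i; j] -> x a c 0 k = 0.
  by rewrite !inE negb_or !mxE /= => /andP[/negPf-> /negPf->]; rewrite !mulr0 addr0.
have xB a c k : (x a c *m B) 0 k = a * B i k + c * B j k.
  by rewrite mulmxDl -!scalemxAl -!rowE !mxE.
have xi a c : x a c 0 i = a by rewrite !mxE !eqxx (negPf ij) mulr1 mulr0 addr0.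
have xj a c : x a c 0 j = c.
  by rewrite !mxE !eqxx eq_sym (negPf ij) mulr1 mulr0 add0r.
(* The pair has no nonzero kernel vector; testing the three nonzero ones leaves a single value for
   [B i j]. *)
have K a c : (a * B i i + c * B i j == 0) && (a * B i j + c * B j j == 0) ==>
    (a == 0) && (c == 0).
  apply/implyP => /andP[/eqP ei /eqP ej]; have x0 : x a c = 0.
    apply: (principal_minor_ker mB) => k; first exact: xs.
    by rewrite xB => /set2P[->|->]; rewrite ?Bji.
  have := xi a c; have := xj a c; rewrite x0 !mxE => <- <-.
  by rewrite eqxx.
apply/eqP; move: (K 1 0) (K 0 1) (K 1 1).
by case: (F2_cases (B i i)) => ->; case: (F2_cases (B i j)) => ->;
  case: (F2_cases (B j j)) => ->.
Qed.

(** Equal diagonal entries make rows [i] and [i'] agree at [j] and [j']. A kernel vector of the pair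
    [j], [j'] can then be corrected by a multiple of e_i + e_i' into one of all four indices, unless
    e_i + e_i' is one already. *)
Lemma principal_minor_quad n (P : 'M['F_2]_n) i i' j j' :
    P^T = P -> uniq [:: i; i'; j; j'] -> P i i = P i' i' ->
    principal_minor P [set i; j] != 0 -> principal_minor P [set i; j'] != 0 ->
    principal_minor P [set i'; j] != 0 -> principal_minor P [set i'; j'] != 0 ->
    principal_minor P (i |: (i' |: [set j; j'])) != 0 ->
  principal_minor P [set j; j'] != 0.
Proof.
move=> PT; rewrite /= !inE !negb_or => /and4P[/and3P[ii ij ij'] /andP[i'j i'j'] jj' _].
move=> Pii mij mij' mi'j mi'j' mQ.
have Pj : P i j = P i' j.
  by rewrite (principal_minor_pair PT ij mij) (principal_minor_pair PT i'j mi'j) Pii.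
have Pj' : P i j' = P i' j'.
  by rewrite (principal_minor_pair PT ij' mij') (principal_minor_pair PT i'j' mi'j') Pii.
have PC a b : P a b = P b a by rewrite -[in LHS]PT mxE.
apply/principal_minor_eq0P => -[z [z0 zs zP]].
have zi : z 0 i = 0 by rewrite zs // !inE negb_or ij ij'.
have zi' : z 0 i' = 0 by rewrite zs // !inE negb_or i'j i'j'.
have zPi : (z *m P) 0 i = (z *m P) 0 i'.
  rewrite !(mulmx_supported _ _ zs) !big_setU1 ?inE ?jj' //= !big_set1.
  by rewrite ![P j _]PC ![P j' _]PC Pj Pj'.
pose w t : 'rV['F_2]_n := z + t *: (delta_mx 0 i + delta_mx 0 i').
have wE t k : w t 0 k = z 0 k + t * ((k == i)%:R + (k == i')%:R) by rewrite !mxE.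
have wP t k : (w t *m P) 0 k = (z *m P) 0 k + t * (P i k + P i' k).
  by rewrite mulmxDl -scalemxAl mulmxDl -!rowE !mxE.
have ws t k : k \notin i |: (i' |: [set j; j']) -> w t 0 k = 0.
  rewrite !inE !negb_or -?andbA => /and4P[/negPf ki /negPf ki' kj kj'].
  by rewrite wE ki ki' addr0 mulr0 addr0 zs // !inE negb_or kj kj'.
have wPj t k : k \in [set j; j'] -> (w t *m P) 0 k = 0.
  move=> kj; rewrite wP zP // add0r.
  by move: kj => /set2P[->|->]; rewrite ?Pj ?Pj' (addrr_pchar2 F2_pchar) mulr0.
(* If this sum is 0, then e_i + e_i' itself is a kernel vector on the four indices. *)
have [s0|s1] := F2_cases (P i i + P i i').
- pose v : 'rV['F_2]_n := delta_mx 0 i + delta_mx 0 i'.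
  have wv t : w t = z + t *: v by [].
  have : v = 0.
    apply: (principal_minor_ker mQ) => k.
    + have := ws 1 k; have := ws 0 k; rewrite !wv scale0r scale1r addr0 mxE.
      by move=> H0 H1 kQ; have := H1 kQ; rewrite H0 // add0r.
    + have vP l : (v *m P) 0 l = P i l + P i' l.
        by rewrite mulmxDl -!rowE !mxE.
      rewrite !inE vP -?orbA => /or4P[] /eqP->.
      * by rewrite [P i' i]PC.
      * by rewrite -Pii addrC.
      * by rewrite Pj (addrr_pchar2 F2_pchar).
      * by rewrite Pj' (addrr_pchar2 F2_pchar).
  by move/rowP/(_ i)/eqP; rewrite !mxE !eqxx (negPf ii) addr0 oner_eq0.
(* Here adding t (e_i + e_i') changes the image at both [i] and [i'] by t, which cancels the common
   value there. *)
- pose t := (z *m P) 0 i.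
  have wt0 : w t = 0.
    apply: (principal_minor_ker mQ) => k; first exact: ws.
    rewrite !inE -?orbA => /or4P[] /eqP->; last first.
    + by apply: wPj; rewrite !inE eqxx orbT.
    + by apply: wPj; rewrite !inE eqxx.
    + by rewrite wP -zPi -Pii [P i i' + _]addrC s1 mulr1 (addrr_pchar2 F2_pchar).
    + by rewrite wP [P i' i]PC s1 mulr1 (addrr_pchar2 F2_pchar).
  case/eqP: z0; apply/rowP => k; rewrite [RHS]mxE.
  have [->//|ki] := eqVneq k i; have [->//|ki'] := eqVneq k i'.
  have /rowP/(_ k) := wt0; rewrite wE (negPf ki) (negPf ki') addr0 mulr0 addr0.
  by rewrite mxE.
Qed.

(* On alpha, B is p p^T + 1 1^T + I with p the diagonal of B. *)
Lemma principal_minor_pairwise n (B : 'M['F_2]_n) (alpha : {set 'I_n}) :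
    {in alpha &, forall i j, i != j -> B i j = B i i * B j j + 1} ->
  (principal_minor B alpha == 0)
    = odd #|alpha| && (\sum_(i in alpha) B i i == 0).
Proof.
move=> BE; set a1 := \sum_(i in alpha) B i i.
have sq (x : 'F_2) : x * x = x by case: (F2_cases x) => ->; rewrite ?mul0r ?mulr1.
(* On the diagonal p_i p_i + 1 + 1 = p_i, so the decomposition of B holds there too and x B splits
   into three terms on [alpha]. *)
have xB (x : 'rV_n) i : (forall k, k \notin alpha -> x 0 k = 0) -> i \in alpha ->
    (x *m B) 0 i = B i i * (\sum_(j in alpha) B j j * x 0 j)
                   + \sum_(j in alpha) x 0 j + x 0 i.
  move=> xs ia; rewrite (mulmx_supported _ _ xs) mulr_sumr -big_split /=.
  rewrite (bigD1 i ia) [X in _ = X + _](bigD1 i ia) /= mulrA sq [RHS]addrAC.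
  rewrite -[B i i * _ + _ + _]addrA (addrr_pchar2 F2_pchar) addr0 [X in X + _]mulrC.
  congr (_ + _); apply: eq_bigr => j /andP[ja ji].
  by rewrite BE // mulrDr mulr1 mulrC -mulrA mulrCA.
have card2 : #|alpha|%:R = (odd #|alpha|)%:R :> 'F_2.
  by apply/val_inj; rewrite /= !val_Fp_nat // modn2 modn_small //; case: odd.
apply/principal_minor_eq0P/andP => [[x [x0 xs xk]]|[oa /eqP a0]]; last first.
  (* The indicator vector of [alpha] is a kernel vector in this case. *)
  exists (\row_i (i \in alpha)%:R); split => [|i ia|i ia].
  - apply/eqP => x0; have /card_gt0P[i ia] : (0 < #|alpha|)%N by case: #|_| oa.
    by have /rowP/(_ i)/eqP := x0; rewrite !mxE ia.
  - by rewrite mxE (negPf ia).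
  - rewrite xB // => [|k ka]; last by rewrite mxE (negPf ka).
    rewrite (eq_bigr (fun j => B j j)); last by move=> j ja; rewrite mxE ja mulr1.
    rewrite -/a1 a0 mulr0 add0r mxE ia.
    rewrite (eq_bigr (fun=> 1)); last by move=> j ja; rewrite mxE ja.
    by rewrite sumr_const card2 oa (addrr_pchar2 F2_pchar).
(* A kernel vector is T p + S 1 on [alpha]. Substituting this into [S] and [T] gives two linear
   equations, which have a nonzero solution only if the order is odd and [a1] is 0. *)
pose S := \sum_(j in alpha) x 0 j; pose T := \sum_(j in alpha) B j j * x 0 j.
have xE i : i \in alpha -> x 0 i = B i i * T + S.
  move=> ia; have := xk i ia; rewrite xB // => /eqP.
  by rewrite addr_eq0 (oppr_pchar2 F2_pchar) => /eqP.
have SE : S = a1 * T + (odd #|alpha|)%:R * S.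
  rewrite {1}/S (eq_bigr _ xE) big_split /= -mulr_suml sumr_const.
  by rewrite -card2 mulr_natl.
have TE : T = a1 * T + a1 * S.
  rewrite {1}/T (eq_bigr (fun i => B i i * T + B i i * S)).
    by rewrite big_split /= -!mulr_suml.
  by move=> i ia; rewrite xE // mulrDr mulrA sq.
have TS : ~~ ((T == 0) && (S == 0)).
  apply: contra x0 => /andP[/eqP T0 /eqP S0]; apply/eqP/rowP => i; rewrite mxE.
  by have [ia|/xs//] := boolP (i \in alpha); rewrite xE // T0 S0 mulr0 addr0.
apply/andP; move: TS SE TE; case: (odd _);
  case: (F2_cases a1) => ->; case: (F2_cases T) => ->; case: (F2_cases S) => ->;
  by move=> // _ /eqP + /eqP.
Qed.

(** * Sizes of symmetric differences, one element at a time *)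

Section Symdiff.

Variable T : finType.
Implicit Types A B : {set T}.

Lemma symdiffv A : symdiff A A = set0.
Proof. by apply/setP => x; rewrite !inE addbb. Qed.

Lemma symdiff0 A : symdiff A set0 = A.
Proof. by apply/setP => x; rewrite !inE addbF. Qed.

Lemma symdiffK A : involutive (symdiff A).
Proof. by move=> B; apply/setP => x; rewrite !inE addKb. Qed.

Lemma symdiff_sub A B : B \subset A -> symdiff A B = A :\: B.
Proof.
move=> /subsetP BA; apply/setP => x; rewrite !inE.
by case: (boolP (x \in B)) => [/BA->|_] //; rewrite addbF.
Qed.

Lemma card_symdiff_in A B x : x \in A -> x \notin B ->
  #|symdiff A B| = #|symdiff A (x |: B)|.+1.
Proof.
move=> xA xB; rewrite (cardsD1 x) inE xA (negPf xB) add1n; congr (#|pred_of_set _|.+1).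
apply/setP => y; rewrite !inE; case: eqP => // ->.
by rewrite xA.
Qed.

Lemma card_symdiff_out A B x : x \notin A -> x \notin B ->
  #|symdiff A (x |: B)| = #|symdiff A B|.+1.
Proof.
move=> xA xB; rewrite (cardsD1 x) !inE (negPf xA) eqxx add1n.
congr (#|pred_of_set _|.+1).
apply/setP => y; rewrite !inE; case: eqP => // ->.
by rewrite (negPf xA) (negPf xB).
Qed.

Lemma card_symdiff1_in A x : x \in A -> #|A| = #|symdiff A [set x]|.+1.
Proof.
move=> xA; rewrite -{1}(symdiff0 A) (card_symdiff_in xA) ?inE //.
by rewrite setU0.
Qed.

Lemma card_symdiff1_out A x : x \notin A -> #|symdiff A [set x]| = #|A|.+1.
Proof.
move=> xA; rewrite -[in RHS](symdiff0 A) -(card_symdiff_out xA) ?inE //.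
by rewrite setU0.
Qed.

End Symdiff.

(** With p and q the entries joining [j] to [i] and [i'], the determinant is 1 + 2pq = 1 over
    $\mathbb{Z}_2$. *)
Lemma principal_minor_triple n (P : 'M['F_2]_n) i i' j :
    P^T = P -> P i i = 0 -> P i' i' = 0 -> P j j = 1 -> P i i' = 1 ->
  principal_minor P (i |: [set i'; j]) != 0.
Proof.
move=> PT Pii Pii' Pjj Pi; have PC a b : P a b = P b a by rewrite -[in LHS]PT mxE.
have ii' : i != i' by apply/eqP => e; move: Pi; rewrite -e Pii.
have ij : i != j by apply/eqP => e; move: Pii; rewrite e Pjj.
have i'j : i' != j by apply/eqP => e; move: Pii'; rewrite e Pjj.
apply/principal_minor_eq0P => -[x [x0 xs xP]].
have E k : (x *m P) 0 k = x 0 i * P i k + (x 0 i' * P i' k + x 0 j * P j k).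
  by rewrite (mulmx_supported _ _ xs) !big_setU1 ?inE ?negb_or ?ii' ?ij //= big_set1.
have := xP i; have := xP i'; have := xP j; rewrite !inE !eqxx ?orbT /= !E.
rewrite Pii Pii' Pjj [P i' i]PC Pi [P j i]PC [P j i']PC.
move=> /(_ isT) ej /(_ isT) ei' /(_ isT) ei.
have : [&& x 0 i == 0, x 0 i' == 0 & x 0 j == 0].
  move: ej ei' ei; move: (x 0 i) (x 0 i') (x 0 j) (P i j) (P i' j) => a b c p q.
  case: (F2_cases a) => ->; case: (F2_cases b) => ->; case: (F2_cases c) => ->;
  case: (F2_cases p) => ->; case: (F2_cases q) => ->;
  by move=> /eqP + /eqP + /eqP.
move=> /and3P[/eqP xi /eqP xi' /eqP xj]; case/eqP: x0; apply/rowP => k.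
rewrite [RHS]mxE; have [kS|/xs//] := boolP (k \in i |: [set i'; j]).
by move: kS; rewrite !inE => /or3P[] /eqP->.
Qed.

(** * Constraints imposed by a letter N or A *)

Section Necessary.

Variables (n : nat) (B : 'M['F_2]_n) (k : nat).
Hypothesis BT : B^T = B.

(* Pivoting on a nonsingular set of order k+1 would yield a matrix with zero
   diagonal, and this property is inherited by B. *)
Lemma principal_minorN_succ i0 :
    B i0 i0 != 0 -> (0 < k)%N ->
    (forall alpha : {set 'I_n}, #|alpha| = k -> principal_minor B alpha = 0) ->
  forall beta : {set 'I_n}, #|beta| = k.+1 -> principal_minor B beta = 0.
Proof.
move=> Bi0 k0 mB beta bk; apply/eqP; apply: contraT => mb.
have [P [PT PE Pd]] := principal_pivot F2_pchar BT mb.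
(* Removing one index from [beta] leaves a set of order k, which is singular. *)
have Pin i : i \in beta -> P i i = 0.
  move=> ib; apply/eqP; rewrite -principal_minor_set1 PE mB //.
  by apply/eqP; rewrite -eqSS -card_symdiff1_in // bk.
(* For P the set [beta] is nonsingular, as it corresponds to the empty set for B; hence P is not
   zero on [beta]. *)
have [i [i' [ib i'b Pi]]] : exists i i', [/\ i \in beta, i' \in beta & P i i' = 1].
  have [/exists_inP[i ib /exists_inP[i' i'b /eqP Pi]]|H] :=
    boolP [exists i in beta, exists i' in beta, P i i' == 1].
    by exists i, i'.
  have : principal_minor P beta != 0.
    by rewrite PE symdiffv principal_minor_set0.
  have /card_gt0P[i ib] : (0 < #|beta|)%N by rewrite bk.
  case/principal_minor_eq0P; exists (delta_mx 0 i); split => [|j jb|j jb].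
  - by apply/eqP => /rowP/(_ i)/eqP; rewrite !mxE !eqxx oner_eq0.
  - by rewrite mxE eqxx /=; case: eqP jb => // ->; rewrite ib.
  - rewrite -rowE mxE; move: H; rewrite negb_exists_in => /forall_inP/(_ i ib).
    rewrite negb_exists_in => /forall_inP/(_ j jb); rewrite -F2_neq0 negbK.
    by move/eqP.
have ii' : i != i' by apply/eqP => e; move: Pi; rewrite -e Pin.
case/eqP: Bi0; apply: Pd => j; have [/Pin//|jb] := boolP (j \in beta).
have ij : i != j by apply: contra jb => /eqP <-.
have i'j : i' != j by apply: contra jb => /eqP <-.
(* Otherwise the triple [i], [i'], [j] is nonsingular for P, although trading [i] and [i'] for [j]
   turns [beta] into a set of order k. *)
have [//|Pj] := F2_cases (P j j).
have := principal_minor_triple PT (Pin i ib) (Pin i' i'b) Pj Pi.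
rewrite PE mB ?eqxx //; apply/eqP; rewrite -eqSS -card_symdiff_in //; last first.
  by rewrite !inE negb_or ii' ij.
rewrite -eqSS -card_symdiff_in //; last by rewrite inE.
by rewrite card_symdiff1_out // bk.
Qed.

Hypotheses (k3 : (3 <= k)%N) (kn : (k.+2 <= n)%N).
Hypothesis mB :
  forall alpha : {set 'I_n}, #|alpha| = k -> principal_minor B alpha != 0.

(** Remove two indices from [gamma] and pivot at the remaining set [alpha] of order k. Sets with as
    many indices inside [alpha] as outside correspond to sets of order k, so the hypotheses of
    [principal_minor_quad] hold and the removed pair is nonsingular for the pivot. *)
Lemma principal_minorA_add2 (gamma : {set 'I_n}) :
  #|gamma| = k.+2 -> principal_minor B gamma != 0.
Proof.
move=> gk; have /card_gt1P[j [j' [jg j'g jj']]] : (1 < #|gamma|)%N by rewrite gk.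
pose alpha := symdiff gamma [set j; j'].
have ak : #|alpha| = k.
  apply/eqP; rewrite -eqSS -card_symdiff_in ?inE //.
  by rewrite -eqSS -card_symdiff1_in // gk.
have jA : j \notin alpha by rewrite !inE jg eqxx.
have j'A : j' \notin alpha by rewrite !inE j'g eqxx orbT.
have [P [PT PE _]] := principal_pivot F2_pchar BT (mB ak).
have gE : gamma = symdiff alpha [set j; j'].
  apply/setP => x; rewrite !inE; case: (x \in gamma); case: (_ || _) => //.
rewrite gE -PE.
(* Among three indices two share a diagonal entry, since there are only two values; this is where k
   >= 3 enters. *)
have [i [i' [iA i'A ii' Pii]]] : exists i i',
    [/\ i \in alpha, i' \in alpha, i != i' & P i i = P i' i'].
  have /card_gt2P[x [y [z [[xA yA zA] [xy yz zx]]]]] : (2 < #|alpha|)%N by rewrite ak.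
  have [xy'|nxy] := eqVneq (P x x) (P y y); first by exists x, y.
  have [yz'|nyz] := eqVneq (P y y) (P z z); first by exists y, z.
  exists z, x; split=> //; move: nxy nyz.
  by case: (F2_cases (P x x)) => ->; case: (F2_cases (P y y)) => ->;
    case: (F2_cases (P z z)) => ->.
have neq x y : x \in alpha -> y \notin alpha -> x != y.
  by move=> xA; apply: contra => /eqP <-.
have m2 x y : x \in alpha -> y \notin alpha -> principal_minor P [set x; y] != 0.
  move=> xA yA; rewrite PE mB //; apply/eqP; rewrite -eqSS -card_symdiff_in //.
    by rewrite card_symdiff1_out // ak.
  by rewrite inE neq.
apply: (principal_minor_quad (i := i) (i' := i')) => //; rewrite ?m2 //.
  by rewrite /= !inE !negb_or ii' jj' !neq.
rewrite PE mB //; apply/eqP; rewrite /alpha -eqSS -card_symdiff_in //; last first.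
  by rewrite !inE !negb_or ii' !neq.
rewrite -eqSS -card_symdiff_in //; last by rewrite !inE !negb_or !neq.
by rewrite -/alpha -gE gk.
Qed.

(** Pivot at a set [gamma] of order k+2 containing [beta]. Pairs in [gamma] correspond to sets of
    order k and are nonsingular, so every even subset of [gamma] is, in particular the complement of
    [beta] in [gamma]. *)
Lemma principal_minorA_parity (beta : {set 'I_n}) :
  (#|beta| <= k.+2)%N -> odd #|beta| = odd k -> principal_minor B beta != 0.
Proof.
move=> bk bo; have [gamma [bg _ gk]] : exists gamma : {set 'I_n},
    [/\ beta \subset gamma, gamma \subset setT & #|gamma| = k.+2].
  by apply: exists_card_between; rewrite ?subsetT // bk cardsT card_ord.
have [Q [QT QE _]] := principal_pivot F2_pchar BT (principal_minorA_add2 gk).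
rewrite -(symdiffK gamma beta) -QE principal_minor_pairwise => [|i j].
  rewrite symdiff_sub // cardsD (setIidPr bg) gk oddB ?bk //= bo.
  by case: (odd k).
rewrite symdiff_sub // => /setDP[ig _] /setDP[jg _] ij.
apply: principal_minor_pair => //; rewrite QE mB //.
apply/eqP; rewrite -eqSS -card_symdiff_in ?inE //.
by rewrite -eqSS -card_symdiff1_in // gk.
Qed.

End Necessary.

Lemma epr_entry_full (F : fieldType) n (B : 'M[F]_n) : epr_entry B n <> LS.
Proof.
move=> /(epr_entryS B (leqnn n))[[a [an a0]] [b [bn b0]]].
by move: b0; rewrite (card_full bn) -(card_full an) a0 eqxx.
Qed.

(** * Letters of a matrix in which every pair is nonsingular *)

Section AllPairs.

Variables (n : nat) (B : 'M['F_2]_n).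
Hypothesis BE : forall i j, i != j -> B i j = B i i * B j j + 1.

Lemma epr_entry_pairwise_even k : ~~ odd k -> epr_entry B k = LA.
Proof.
move=> ok; apply/epr_entryA => alpha ak.
by rewrite principal_minor_pairwise ?ak ?(negPf ok) // => i j _ _; apply: BE.
Qed.

(** Adding [i0] or [j0] to a common set of order k-1 gives diagonal sums that differ by 1, so
    exactly one of the two sets is singular. The bound k < n leaves room for the common set outside
    [i0] and [j0]. *)
Lemma epr_entry_pairwise_odd k i0 j0 :
  B i0 i0 = 1 -> B j0 j0 = 0 -> odd k -> (k < n)%N -> epr_entry B k = LS.
Proof.
move=> Bi Bj ok kn; have ij : i0 != j0 by apply/eqP => e; move: Bj; rewrite -e Bi.
have [gamma [_ gS gk]] : exists gamma : {set 'I_n},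
    [/\ set0 \subset gamma, gamma \subset ~: [set i0; j0] & #|gamma| = k.-1].
  apply: exists_card_between; first exact: sub0set.
  by rewrite cards0 [#|~: _|]cardsCs setCK cards2 ij card_ord; lia.
have mE x : x \in [set i0; j0] -> #|x |: gamma| = k /\
    (principal_minor B (x |: gamma) == 0) = (B x x + \sum_(i in gamma) B i i == 0).
  move=> xS; have xg : x \notin gamma.
    by apply: contraL xS => /(subsetP gS); rewrite inE.
  have xk : #|x |: gamma| = k by rewrite cardsU1 xg gk; case: k ok {kn gk}.
  split=> //; rewrite principal_minor_pairwise ?xk ?ok ?big_setU1 //.
  by move=> i j _ _; apply: BE.
have [[ik mi] [jk mj]] := (mE i0 (set21 _ _), mE j0 (set22 _ _)).
apply/epr_entryS; first exact: ltnW.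
rewrite Bi Bj add0r in mi mj; have [s|s] := F2_cases (\sum_(i in gamma) B i i).
- rewrite s addr0 in mi mj; split.
    by exists (j0 |: gamma); split=> //; apply/eqP; rewrite mj.
  by exists (i0 |: gamma); rewrite mi.
- rewrite s (addrr_pchar2 F2_pchar) in mi mj; split.
    by exists (i0 |: gamma); split=> //; apply/eqP; rewrite mi.
  by exists (j0 |: gamma); rewrite mj.
Qed.

Lemma epr_entry_pairwise_full : odd n ->
  epr_entry B n = if \sum_i B i i == 0 then LN else LA.
Proof.
move=> on; have mT (alpha : {set 'I_n}) : #|alpha| = n ->
    (principal_minor B alpha == 0) = (\sum_i B i i == 0).
  move=> /card_full->; rewrite principal_minor_pairwise; last by move=> i j _ _; apply: BE.
  by rewrite cardsT card_ord on; congr (_ == _); apply: eq_bigl => i; rewrite inE.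
case: ifP => s; first by apply/epr_entryN => // alpha /mT/eqP; rewrite s => /eqP/eqP.
by apply/epr_entryA => alpha /mT ->; rewrite s.
Qed.

End AllPairs.

(** * Constant and alternating runs of letters *)

Lemma map_iota_const (f : nat -> epr_letter) l a m :
  (forall k, (a <= k < a + m)%N -> f k = l) -> map f (iota a m) = rep m [:: l].
Proof.
elim: m a => //= m IHm a fl; rewrite fl ?IHm ?leqnn ?addnS ?leq_addr //.
by move=> k /andP[ak km]; rewrite fl // (ltnW ak) -addSnnS km.
Qed.

Lemma map_iota_alt (f : nat -> epr_letter) a m :
  (forall k, (a <= k < a + m.*2)%N -> f k = if odd (k - a) then LA else LS) ->
  map f (iota a m.*2) = rep m [:: LS; LA].
Proof.
elim: m a => // m IHm a fE; rewrite doubleS /= IHm; last first.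
  move=> k km; rewrite fE; last lia.
  have -> : (k - a = (k - a.+2).+2)%N by lia.
  by rewrite /= negbK.
by rewrite !fE ?subnn ?subSnn //; lia.
Qed.

(** * Diagonal matrices and identity blocks *)

Section Constructions.

Variable F : fieldType.

Lemma principal_minor_setT n (B : 'M[F]_n) :
  (principal_minor B setT == 0) = (\det B == 0).
Proof.
apply/principal_minor_eq0P/det0P => [[x [x0 _ xB]]|[x x0 xB]].
- by exists x => //; apply/rowP => i; rewrite xB ?inE // mxE.
- by exists x; split=> // i; rewrite ?inE // xB mxE.
Qed.

Lemma principal_minor_diag n (d : 'rV[F]_n) (alpha : {set 'I_n}) :
  (principal_minor (diag_mx d) alpha == 0) = [exists i in alpha, d 0 i == 0].
Proof.
apply/principal_minor_eq0P/exists_inP => [[x [x0 xs xB]]|[i ia /eqP di]].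
- apply/exists_inP; apply: contraNT x0 => /exists_inPn H; apply/eqP/rowP => i.
  rewrite [RHS]mxE; have [ia|/xs//] := boolP (i \in alpha).
  have := xB i ia; rewrite mul_mx_diag mxE => /eqP.
  by rewrite mulf_eq0 (negPf (H i ia)) orbF => /eqP.
- exists (delta_mx 0 i); split=> [|j ja|j ja].
  + by apply/eqP => /rowP/(_ i)/eqP; rewrite !mxE !eqxx oner_eq0.
  + by rewrite mxE eqxx /=; case: eqP ja => // ->; rewrite ia.
  + rewrite mul_mx_diag !mxE eqxx /=.
    by case: eqP => [->|]; rewrite ?di ?mulr0 ?mul0r.
Qed.

(** A kernel vector vanishes on the indices of the identity block, so only the part of [alpha]
    inside C counts. *)
Lemma principal_minor_block1 c m (C : 'M[F]_c) (alpha : {set 'I_(c + m)}) :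
  (principal_minor (block_mx C 0 0 1%:M) alpha == 0)
    = (principal_minor C (lshift m @^-1: alpha) == 0).
Proof.
have blockE (y : 'rV_c) (z : 'rV_m) :
    row_mx y z *m block_mx C 0 0 1%:M = row_mx (y *m C) z.
  by rewrite mul_row_block !mulmx0 mulmx1 addr0 add0r.
apply/principal_minor_eq0P/principal_minor_eq0P => -[x [x0 xs xB]].
- rewrite -(hsubmxK x) blockE in xB.
  have xr : rsubmx x = 0.
    apply/rowP => i; rewrite [RHS]mxE.
    have [ia|ia] := boolP (rshift c i \in alpha); last by rewrite mxE xs.
    by have := xB _ ia; rewrite row_mxEr.
  exists (lsubmx x); split=> [|i|i]; rewrite ?inE.
  + by apply: contra x0 => /eqP xl; rewrite -(hsubmxK x) xl xr row_mx0.
  + by rewrite mxE => /xs.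
  + by move=> /xB; rewrite row_mxEl.
- exists (row_mx x 0); split=> [|i|i].
  + by apply: contra x0; rewrite row_mx_eq0 => /andP[].
  + rewrite -(splitK i); case: (split i) => j /= ia.
      by rewrite row_mxEl xs // inE.
    by rewrite row_mxEr mxE.
  + rewrite blockE -(splitK i); case: (split i) => j /= ia.
      by rewrite row_mxEl xB // inE.
    by rewrite row_mxEr mxE.
Qed.

Lemma tr_block1 c m (C : 'M[F]_c) :
  C^T = C -> (block_mx C 0 0 1%:M : 'M_(c + m))^T = block_mx C 0 0 1%:M.
Proof. by move=> CT; rewrite tr_block_mx CT !trmx0 trmx1. Qed.

(** One index x of C together with k-1 indices of the identity block has the same singularity as the
    entry [C x x]; the choices x = i and x = j give both outcomes. *)
Lemma epr_entry_block1 c m (C : 'M[F]_c) i j k :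
    C i i != 0 -> C j j = 0 -> (1 <= k <= m.+1)%N ->
  epr_entry (block_mx C 0 0 1%:M : 'M_(c + m)) k = LS.
Proof.
move=> Ci Cj km; have [gamma [_ _ gk]] : exists gamma : {set 'I_m},
    [/\ set0 \subset gamma, gamma \subset setT & #|gamma| = k.-1].
  by apply: exists_card_between; rewrite ?sub0set // cards0 cardsT card_ord; lia.
pose alpha x : {set 'I_(c + m)} := lshift m x |: @rshift c m @: gamma.
have xg x : lshift m x \notin @rshift c m @: gamma.
  by apply/imsetP => -[y _] /eqP; rewrite eq_lrshift.
have aE x : #|alpha x| = k /\ (principal_minor
    (block_mx C 0 0 1%:M : 'M_(c + m)) (alpha x) == 0) = (C x x == 0).
  split; first by rewrite cardsU1 xg card_imset ?gk; [lia|exact: rshift_inj].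
  rewrite principal_minor_block1 -principal_minor_set1; congr (principal_minor C _ == 0).
  apply/setP => y; rewrite !inE eq_lshift; case: eqP => //= _.
  by rewrite (negPf (xg y)).
apply/epr_entryS; first by have := ltn_ord i; lia.
have [[ik mi] [jk mj]] := (aE i, aE j); split.
  by exists (alpha j); split=> //; apply/eqP; rewrite mj Cj.
by exists (alpha i); rewrite mi.
Qed.

End Constructions.

(* All row sums of the bordered matrix vanish and C is its lower right block. *)
Definition zero_sum_border (F : fieldType) n (C : 'M[F]_n) : 'M[F]_(1 + n) :=
  let Q : 'M[F]_(n, 1 + n) := row_mx (const_mx (- 1)) 1%:M in Q^T *m C *m Q.

(** * Principal minors of the bordered matrix *)

Section Border.

Variables (F : fieldType) (n : nat) (C : 'M[F]_n).

Let Q : 'M[F]_(n, 1 + n) := row_mx (const_mx (- 1)) 1%:M.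

Let Q1 : Q *m const_mx 1 = 0 :> 'cV_n.
Proof.
apply/colP => i; rewrite mxE big_split_ord /= big_ord1 !mxE.
rewrite (unsplitK (inl _)) mxE mulr1 (bigD1 i) //= big1 => [|j ji].
  by rewrite !mxE (unsplitK (inr _)) !mxE eqxx mulr1 addr0 addNr.
by rewrite !mxE (unsplitK (inr _)) !mxE eq_sym (negPf ji) mul0r.
Qed.

Lemma tr_zero_sum_border : C^T = C -> (zero_sum_border C)^T = zero_sum_border C.
Proof. by move=> CT; rewrite /zero_sum_border !trmx_mul trmxK CT mulmxA. Qed.

Lemma principal_minor_border_rshift (beta : {set 'I_n}) :
  (principal_minor (zero_sum_border C) (@rshift 1 n @: beta) == 0)
    = (principal_minor C beta == 0).
Proof.
have rowE (y : 'rV_n) : rsubmx (row_mx (0 : 'rV_1) y *m zero_sum_border C) = y *m C.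
  rewrite /zero_sum_border !mulmxA tr_row_mx mul_row_col mul0mx add0r.
  by rewrite trmx1 mulmx1 mul_mx_row row_mxKr mulmx1.
have memE i : (rshift 1 i \in @rshift 1 n @: beta) = (i \in beta).
  by rewrite mem_imset //; apply: rshift_inj.
have lE : lshift n ord0 \notin @rshift 1 n @: beta.
  by apply/imsetP => -[y _] /eqP; rewrite eq_lrshift.
apply/principal_minor_eq0P/principal_minor_eq0P => -[x [x0 xs xB]].
- have xE : x = row_mx 0 (rsubmx x).
    rewrite -{1}(hsubmxK x); congr (row_mx _ _); apply/rowP => i.
    by rewrite !mxE ord1 xs.
  exists (rsubmx x); split=> [|i ib|i ib].
  + by apply: contra x0 => /eqP xr; rewrite xE xr row_mx0.
  + by rewrite mxE xs // memE.
  + by rewrite -rowE -xE mxE xB // memE.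
- exists (row_mx 0 x); split=> [|i|i].
  + by apply: contra x0; rewrite row_mx_eq0 => /andP[].
  + rewrite -(splitK i); case: (split i) => j /= ib; first by rewrite row_mxEl mxE.
    by rewrite row_mxEr xs // -memE.
  + move=> /imsetP[j jb ->]; have := xB j jb.
    by rewrite -rowE mxE.
Qed.

Lemma principal_minor_border_setT :
  principal_minor (zero_sum_border C) setT = 0.
Proof.
apply/eqP; rewrite principal_minor_setT -det_tr; apply/det0P.
exists (const_mx 1); first by apply/eqP => /rowP/(_ ord0)/eqP; rewrite !mxE oner_eq0.
apply: trmx_inj; rewrite trmx_mul trmxK trmx0 trmx_const /zero_sum_border.
by rewrite -!mulmxA Q1 !mulmx0.
Qed.

(** The entries of x B sum to zero, so if all but the one at [i] vanish, then x B = 0. As C is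
    invertible and Q has a right inverse, x Q^T = 0, which makes x constant; it is zero at [i]. *)
Lemma principal_minor_border_setC1 i :
  \det C != 0 -> principal_minor (zero_sum_border C) (~: [set i]) != 0.
Proof.
move=> dC; apply/principal_minor_eq0P => -[x [x0 xs xB]].
have Cu : C \in unitmx by rewrite unitmxE unitfE.
have xBi : (x *m zero_sum_border C) 0 i = 0.
  have : (x *m zero_sum_border C *m const_mx 1 : 'M_1) 0 0 = 0.
    by rewrite /zero_sum_border -!mulmxA Q1 !mulmx0 mxE.
  rewrite mxE (bigD1 i) //= big1 => [|j ji].
    by rewrite addr0 [X in _ * X]mxE mulr1.
  by rewrite xB ?inE // mul0r.
have xB0 : x *m zero_sum_border C = 0.
  apply/rowP => j; rewrite [RHS]mxE; have [->//|ji] := eqVneq j i.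
  by rewrite xB // !inE.
have xQ : x *m Q^T = 0.
  have QK : Q *m col_mx 0 1%:M = 1%:M by rewrite mul_row_col mulmx0 mulmx1 add0r.
  have := congr1 (fun y => y *m (col_mx 0 1%:M) *m invmx C) xB0.
  by rewrite /zero_sum_border !mulmxA -(mulmxA _ Q) QK mulmx1 (mulmxK Cu) !mul0mx.
have xc j : x 0 (rshift 1 j) = x 0 (lshift n ord0).
  have := congr1 (fun y : 'rV_n => y 0 j) xQ.
  rewrite -{1}(hsubmxK x) tr_row_mx mul_row_col trmx1 mulmx1 !mxE big_ord1 !mxE.
  by rewrite mulrN1 addrC => /subr0_eq.
have xi : x 0 i = 0 by rewrite xs // !inE eqxx.
have x00 : x 0 (lshift n ord0) = 0.
  rewrite -xi -(splitK i); case: (split i) => j /=; last by rewrite xc.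
  by rewrite (ord1 j).
case/eqP: x0; apply/rowP => j; rewrite [RHS]mxE -(splitK j).
by case: (split j) => l /=; rewrite ?xc ?(ord1 l).
Qed.

End Border.

(** * The symmetric matrix with given diagonal and all pairs nonsingular *)

Definition pairwise_mx n (d : 'I_n -> 'F_2) : 'M['F_2]_n :=
  \matrix_(i, j) if i == j then d i else d i * d j + 1.

Section PairwiseMx.

Variables (n : nat) (d : 'I_n -> 'F_2).

Lemma tr_pairwise_mx : (pairwise_mx d)^T = pairwise_mx d.
Proof.
by apply/matrixP => i j; rewrite !mxE eq_sym mulrC; case: eqP => // ->.
Qed.

Lemma pairwise_mx_diag i : pairwise_mx d i i = d i.
Proof. by rewrite mxE eqxx. Qed.

Lemma pairwise_mx_offdiag i j : i != j ->
  pairwise_mx d i j = pairwise_mx d i i * pairwise_mx d j j + 1.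
Proof. by move=> ij; rewrite !pairwise_mx_diag mxE (negPf ij). Qed.

End PairwiseMx.

(** Even orders give A and odd orders below n give S; only the last letter for odd n stays open. *)
Lemma epr_pairwise n (B : 'M['F_2]_n) i0 j0 :
    (forall i j, i != j -> B i j = B i i * B j j + 1) ->
    B i0 i0 = 1 -> B j0 j0 = 0 ->
  epr B = rep n./2 [:: LS; LA] ++ (if odd n then [:: epr_entry B n] else [::]).
Proof.
move=> BE Bi Bj; have fE k : (1 <= k < 1 + n./2.*2)%N ->
    epr_entry B k = if odd (k - 1) then LA else LS.
  move=> kn; have -> : odd (k - 1) = ~~ odd k.
    by case: k kn => // k _; rewrite subn1 /= negbK.
  case: ifP => [|/negbFE] ok; first exact: epr_entry_pairwise_even.
  apply: (epr_entry_pairwise_odd BE Bi Bj ok).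
  by have := odd_double_half k; have := odd_double_half n; rewrite ok; lia.
rewrite /epr -[X in iota 1 X](odd_double_half n) addnC iotaD map_cat.
rewrite map_iota_alt //; congr (_ ++ _); case: ifP => on //=.
by congr [:: epr_entry _ _]; lia.
Qed.

Lemma sum_head_indicator n : \sum_(i < n.+1) (i == ord0)%:R = 1 :> 'F_2.
Proof. by rewrite (bigD1 ord0) //= big1 ?addr0 // => i /negPf->. Qed.

(** The whole set has diagonal sum 1. A proper set is allowed only for c = 2, and then it has two
    elements, an even order. *)
Lemma pairwise_mx_head_minor c (beta : {set 'I_c.+1}) : (c <= 2)%N ->
    (#|~: beta| <= 1)%N -> (c <= 1)%N ==> (beta == setT) ->
  principal_minor (pairwise_mx (fun i : 'I_c.+1 => (i == ord0)%:R)) beta != 0.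
Proof.
move=> c2 b1 bT; rewrite principal_minor_pairwise; last first.
  by move=> i j _ _; apply: pairwise_mx_offdiag.
have [bE|bE] := eqVneq beta setT.
  rewrite bE negb_and; apply/orP; right.
  rewrite (eq_bigl xpredT) => [|i]; last by rewrite inE.
  under eq_bigr => i _ do rewrite pairwise_mx_diag.
  by rewrite sum_head_indicator oner_eq0.
move: bT; rewrite (negPf bE) implybF -ltnNge => c1.
have cE : c = 2%N by lia.
have : (#|beta| + #|~: beta| = 3)%N by rewrite cardsC card_ord cE.
have : #|~: beta| != 0%N.
  by rewrite cards_eq0; apply: contra bE => /eqP b0; rewrite -(setCK beta) b0 setC0.
move=> n0 bb; have -> : #|beta| = 2%N by lia.
by [].
Qed.

Lemma epr_SA_head n : (0 < n)%N ->
  let B := pairwise_mx (fun i : 'I_n.+1 => (i == ord0)%:R) in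
  epr B = rep n.+1./2 [:: LS; LA] ++ (if odd n.+1 then [:: LA] else [::]).
Proof.
move=> n0 B; rewrite (@epr_pairwise _ B ord0 (inord 1)); first last.
- by rewrite pairwise_mx_diag -val_eqE /= inordK.
- by rewrite pairwise_mx_diag eqxx.
- by move=> i j; apply: pairwise_mx_offdiag.
congr (_ ++ _); case: ifP => // on; rewrite epr_entry_pairwise_full //; last first.
  by move=> i j; apply: pairwise_mx_offdiag.
under eq_bigr => i _ do rewrite pairwise_mx_diag.
by rewrite sum_head_indicator.
Qed.

(** The diagonal has n ones with n even, so its sum is 0 and the full set, of odd order, is
    singular. *)
Lemma epr_SA_tail n : (0 < n)%N -> odd n.+1 ->
  let B := pairwise_mx (fun i : 'I_n.+1 => (i != ord0)%:R) in
  epr B = rep n.+1./2 [:: LS; LA] ++ [:: LN].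
Proof.
move=> n0 on B; rewrite (@epr_pairwise _ B (inord 1) ord0) ?on; first last.
- by rewrite pairwise_mx_diag eqxx.
- by rewrite pairwise_mx_diag -val_eqE /= inordK.
- by move=> i j; apply: pairwise_mx_offdiag.
rewrite epr_entry_pairwise_full //; last first.
  by move=> i j; apply: pairwise_mx_offdiag.
under eq_bigr => i _ do rewrite pairwise_mx_diag.
rewrite big_ord_recl /= add0r (eq_bigr (fun=> 1)) // sumr_const card_ord.
have -> : n = n./2.*2 by rewrite /= in on; rewrite even_halfK.
by rewrite -mul2n mulrnA (mulr2n 1) (addrr_pchar2 F2_pchar) mul0rn.
Qed.

(** * A small block enlarged by an identity matrix *)

Definition S_block c m : 'M['F_2]_(c.+1 + m) :=
  block_mx (pairwise_mx (fun i : 'I_c.+1 => (i == ord0)%:R)) 0 0 1%:M.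

Lemma tr_S_block c m : (S_block c m)^T = S_block c m.
Proof. exact/tr_block1/tr_pairwise_mx. Qed.

Lemma epr_entry_S_block c m k : (0 < c)%N -> (1 <= k <= m.+1)%N ->
  epr_entry (S_block c m) k = LS.
Proof.
move=> c0; apply: (@epr_entry_block1 _ _ _ _ ord0 (inord 1)).
- by rewrite pairwise_mx_diag eqxx.
- by rewrite pairwise_mx_diag -val_eqE /= inordK.
Qed.

Lemma epr_entry_S_block_full c m : (c <= 2)%N ->
  epr_entry (S_block c m) (c.+1 + m) = LA.
Proof.
move=> c2; apply/epr_entryA => alpha /card_full->; rewrite principal_minor_block1 preimsetT.
by rewrite pairwise_mx_head_minor ?setCT ?cards0 ?eqxx ?implybT.
Qed.

(** Omitting one index removes at most one from the block of order 3, and what remains there is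
    nonsingular. *)
Lemma epr_entry_S_block_penult m : epr_entry (S_block 2 m) m.+2 = LA.
Proof.
apply/epr_entryA => alpha ak; rewrite principal_minor_block1.
have ca : #|~: alpha| = 1%N by have := cardsC alpha; rewrite card_ord ak; lia.
apply: pairwise_mx_head_minor => //; rewrite -preimsetC.
suff : (#|lshift m @^-1: (~: alpha)| <= #|~: alpha|)%N by rewrite ca.
rewrite -(card_imset _ (@lshift_inj 3 m)); apply: subset_leq_card.
by rewrite sub_imset_pre.
Qed.

(** * Attainability of the seven forms *)

Lemma attainable_SN a b :
  attainable 'F_2 ([:: LS] ++ rep a [:: LS] ++ [:: LN] ++ rep b [:: LN]).
Proof.
(* With a+1 ones followed by b+1 zeros on the diagonal, a set is nonsingular exactly when it lies
   among the ones. *)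
pose d : 'rV['F_2]_(a.+1 + b.+1) := \row_i (i < a.+1)%:R.
exists (a.+1 + b.+1)%N, (diag_mx d); split=> //; first exact: tr_diag_mx.
pose D := [set lshift b.+1 i | i : 'I_a.+1].
have DE i : (i \in D) = (i < a.+1)%N.
  apply/imsetP/idP => [[j _ ->]|ia]; first exact: (ltn_ord j).
  by exists (Ordinal ia) => //; apply/val_inj.
have cD : #|D| = a.+1 by rewrite card_imset ?cardsT ?card_ord //; apply: lshift_inj.
have mE alpha : (principal_minor (diag_mx d) alpha == 0) = ~~ (alpha \subset D).
  rewrite principal_minor_diag; apply/exists_inP/subsetPn => -[i ia iD];
    exists i => //; move: iD; rewrite DE mxE; by case: ltnP.
rewrite /epr iotaD map_cat (@map_iota_const _ LS) => [|k kn]; last first.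
  apply/epr_entryS; first by lia.
  split.
  - have [alpha [Na _ ak]] : exists alpha : {set 'I_(a.+1 + b.+1)},
        [/\ [set rshift a.+1 ord0] \subset alpha, alpha \subset setT & #|alpha| = k].
      by apply: exists_card_between; rewrite ?subsetT // cards1 cardsT card_ord; lia.
    exists alpha; split=> //; apply/eqP; rewrite mE.
    apply/subsetPn; exists (rshift a.+1 ord0); first by rewrite -sub1set.
    by rewrite DE /= -leqNgt leq_addr.
  - have [alpha [_ aD ak]] : exists alpha : {set 'I_(a.+1 + b.+1)},
        [/\ set0 \subset alpha, alpha \subset D & #|alpha| = k].
      by apply: exists_card_between; rewrite ?sub0set // cards0 cD; lia.
    by exists alpha; rewrite mE negbK.
rewrite (@map_iota_const _ LN) // => k kn.
apply/epr_entryN => [|alpha ak]; first by lia.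
apply/eqP; rewrite mE; apply/negP => /subset_leq_card; rewrite ak cD; lia.
Qed.

Lemma iota_split m n k : n = (m + k)%N -> iota 1 n = iota 1 m ++ iota m.+1 k.
Proof. by move=> ->; rewrite iotaD. Qed.

Lemma attainable_SA a : attainable 'F_2 ([:: LS] ++ rep a [:: LS] ++ [:: LA]).
Proof.
exists (2 + a)%N, (S_block 1 a); split=> //; first exact: tr_S_block.
rewrite /epr (@iota_split a.+1 _ 1); last by lia.
rewrite map_cat (@map_iota_const _ LS) => [|k kn].
  congr (_ ++ [:: _]); exact: (epr_entry_S_block_full a (leqnSn 1)).
by rewrite epr_entry_S_block //; lia.
Qed.

Lemma attainable_SAA a :
  attainable 'F_2 ([:: LS] ++ rep a [:: LS] ++ [:: LA; LA]).
Proof.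
exists (3 + a)%N, (S_block 2 a); split=> //; first exact: tr_S_block.
rewrite /epr (@iota_split a.+1 _ 2); last by lia.
rewrite map_cat (@map_iota_const _ LS) => [|k kn].
  congr (_ ++ [:: _; _]); first exact: epr_entry_S_block_penult.
  exact: (epr_entry_S_block_full a (leqnn 2)).
by rewrite epr_entry_S_block //; lia.
Qed.

(** Bordering an invertible matrix C of order a+3 makes the full set singular and every set missing
    one index nonsingular. The orders up to a+2 inherit S from C, which is a principal submatrix. *)
Lemma attainable_SAN a :
  attainable 'F_2 ([:: LS; LS] ++ rep a [:: LS] ++ [:: LA; LN]).
Proof.
pose C := S_block 1 a.+1; pose B := zero_sum_border C.
exists (1 + (2 + a.+1))%N, B; split=> //.
  exact/tr_zero_sum_border/tr_S_block.
have cR (beta : {set 'I_(2 + a.+1)}) : #|@rshift 1 _ @: beta| = #|beta|.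
  by rewrite card_imset //; apply: rshift_inj.
rewrite /epr (@iota_split a.+2 _ 2); last by lia.
rewrite map_cat (@map_iota_const _ LS) => [|k kn].
  congr (_ ++ [:: _; _]).
  - apply/epr_entryA => alpha ak.
    have : #|~: alpha| == 1%N.
      by have := cardsC alpha; rewrite card_ord ak => e; apply/eqP; lia.
    case/cards1P => i aE; rewrite -(setCK alpha) aE.
    apply: principal_minor_border_setC1; rewrite -principal_minor_setT.
    have /epr_entryA := epr_entry_S_block_full a.+1 (leqnSn 1).
    by apply; rewrite cardsT card_ord.
  - apply/epr_entryN => [|alpha]; first by lia.
    by move=> /card_full->; apply: principal_minor_border_setT.
have /epr_entryS : epr_entry C k = LS by apply: epr_entry_S_block => //; lia.
case=> [|[al [alk al0]] [be [bek be0]]]; first by lia.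
apply/epr_entryS; first by lia.
split.
- exists (@rshift 1 _ @: al); rewrite cR; split=> //.
  by apply/eqP; rewrite principal_minor_border_rshift al0.
- by exists (@rshift 1 _ @: be); rewrite cR principal_minor_border_rshift.
Qed.

(** The boolean [m] covers the forms with and without a final A: the order is odd exactly when [m]
    is true. *)
Lemma attainable_SASA a m :
  attainable 'F_2 ([:: LS; LA; LS; LA] ++ rep a [:: LS; LA] ++ nseq (m : bool) LA).
Proof.
exists (m + a.+2.*2)%N; rewrite doubleS addnS.
exists (pairwise_mx (fun i => (i == ord0)%:R)); split=> //.
  exact: tr_pairwise_mx.
rewrite epr_SA_head; last by lia.
have -> : odd (m + a.*2.+3).+1 = m by rewrite /= !oddD /= oddb odd_double; case: m.
have -> : ((m + a.*2.+3).+1)./2 = a.+2 by case: m; lia.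
by case: m.
Qed.

Lemma attainable_SASAN a :
  attainable 'F_2 ([:: LS; LA] ++ rep a [:: LS; LA] ++ [:: LN]).
Proof.
exists a.+1.*2.+1, (pairwise_mx (fun i => (i != ord0)%:R)); split=> //.
  exact: tr_pairwise_mx.
rewrite epr_SA_tail //; last by rewrite /= odd_double.
by rewrite (_ : (a.+1.*2.+1)./2 = a.+1)%N //; lia.
Qed.

(** * Classification of the sequences that start with S *)

Lemma epr_cases n (B : 'M['F_2]_n) (f := epr_entry B) :
    (0 < n)%N -> B^T = B -> f 1%N = LS ->
  [\/ exists a b, epr B = [:: LS] ++ rep a [:: LS] ++ [:: LN] ++ rep b [:: LN],
      exists a, epr B = [:: LS] ++ rep a [:: LS] ++ [:: LA],
      exists a, epr B = [:: LS] ++ rep a [:: LS] ++ [:: LA; LA]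
    | exists a, epr B = [:: LS; LS] ++ rep a [:: LS] ++ [:: LA; LN]] \/
  exists a, epr B = rep a.+1 [:: LS; LA]
                    ++ (if odd n then [:: f n] else [::]).
Proof.
move=> n0 BT f1.
have /epr_entryS : epr_entry B 1 = LS by [].
case=> // -[al [/eqP/cards1P[j0 ->] /eqP]].
rewrite principal_minor_set1 => /eqP Bj [be [/eqP/cards1P[i0 ->]]].
rewrite principal_minor_set1 => Bi.
have n2 : (2 <= n)%N.
  rewrite ltn_neqAle n0 andbT; apply/eqP => n1.
  by apply: (@epr_entry_full _ _ B); rewrite -[in RHS]f1 /f; congr epr_entry.
have [f2|f2] : f 2%N = LA \/ f 2%N <> LA by case: (f 2%N); [left|right|right].
  right; exists n./2.-1; rewrite (@epr_pairwise _ B i0 j0) //.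
  - by rewrite prednK // half_gt0.
  - move=> i j ij; apply: principal_minor_pair => //.
    by move/epr_entryA: f2; apply; rewrite cards2 ij.
  - by apply/eqP; rewrite -F2_neq0.
(* Let m be the first order whose letter is not S; it exists because the letter of full order is
   never S. *)
left; pose P k := (0 < k)%N && (if f k is LS then false else true).
have exP : exists k, P k.
  by exists n; rewrite /P n0 /f; case e : epr_entry => //; case: (epr_entry_full e).
case: (ex_minnP exP) => m Pm m_min.
have mn : (m <= n)%N.
  apply: m_min; rewrite /P n0 /f; case e : epr_entry => //.
  by case: (epr_entry_full e).
have fS k : (1 <= k < m)%N -> f k = LS.
  move=> /andP[k0 km]; have := m_min k; rewrite /P k0 leqNgt km.
  by case: (f k) => // /(_ isT).
have m2 : (2 <= m)%N.
  case/andP: Pm; case: m {m_min mn fS} => [|[|m]] //= _.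
  by rewrite f1.
case fm : (f m) => //; last 2 first.
- by move: Pm; rewrite /P fm andbF.
- constructor 1; exists m.-2, (n - m)%N.
  have fN k : (m <= k <= n)%N -> f k = LN.
    elim: k => [|k IHk] /andP[]; first by lia.
    rewrite leq_eqVlt => /predU1P[<- //|mk kn].
    have /epr_entryN : f k = LN by apply: IHk; lia.
    move=> /(_ (ltnW kn)) kN; apply/epr_entryN => //.
    by apply: (principal_minorN_succ BT Bi) => //; lia.
  rewrite /epr (@iota_split m.-1 _ (n - m).+1); last by lia.
  rewrite map_cat (@map_iota_const _ LS) => [|k km]; last by apply: fS; lia.
  rewrite (@map_iota_const _ LN) => [|k km]; last by apply: fN; lia.
  by have -> : m.-1 = m.-2.+1 by lia.
have m3 : (3 <= m)%N.
  by rewrite ltn_neqAle m2 andbT; apply/eqP => e; case: f2; rewrite e.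
have nm : (n <= m.+1)%N.
  rewrite leqNgt; apply/negP => mn2.
  (* If A were followed by two more letters, an odd m would make the singular singleton of [j0]
     nonsingular, and an even m would make the second letter A. *)
  have mA := principal_minorA_parity BT m3 mn2 (proj1 (epr_entryA B m) fm).
  have [om|om] := boolP (odd m).
    have := mA [set j0]; rewrite cards1 om principal_minor_set1 Bj eqxx.
    by move=> /(_ isT erefl).
  case: f2; apply/epr_entryA => alpha a2; apply: mA; rewrite a2 //.
  by rewrite (negPf om).
have [nE|nE] : n = m \/ n = m.+1 by lia.
- constructor 2; exists m.-2.
  rewrite /epr (@iota_split m.-1 _ 1); last by lia.
  rewrite map_cat (@map_iota_const _ LS) => [|k km]; last by apply: fS; lia.
  have -> : m.-1 = m.-2.+1 by lia.
  by congr (_ ++ [:: _]); rewrite -fm; congr f; lia.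
- have eE : epr B = rep m.-1 [:: LS] ++ [:: LA; f n].
    rewrite /epr (@iota_split m.-1 _ 2); last by lia.
    rewrite map_cat (@map_iota_const _ LS) => [|k km]; last by apply: fS; lia.
    by congr (_ ++ [:: _; _]); rewrite -?fm; congr epr_entry; lia.
  rewrite eE; case fn : (f n).
  + by constructor 3; exists m.-2; have -> : m.-1 = m.-2.+1 by lia.
  + by case: (epr_entry_full fn).
  (* Since m >= 3, at least two letters S precede the A. *)
  + by constructor 4; exists m.-1.-2; have -> : m.-1 = m.-1.-2.+2 by lia.
Qed.

Theorem theorem3p11 (s : seq epr_letter) (hS : ohead s = Some LS) :
  attainable 'F_2 s <->
  (exists a b : nat, s = [:: LS] ++ rep a [:: LS] ++ [:: LN] ++ rep b [:: LN]) \/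
  (exists a : nat, s = [:: LS] ++ rep a [:: LS] ++ [:: LA]) \/
  (exists a : nat, s = [:: LS] ++ rep a [:: LS] ++ [:: LA; LA]) \/
  (exists a : nat, s = [:: LS; LS] ++ rep a [:: LS] ++ [:: LA; LN]) \/
  (exists a : nat, s = [:: LS; LA; LS; LA] ++ rep a [:: LS; LA]) \/
  (exists a : nat, s = [:: LS; LA; LS; LA] ++ rep a [:: LS; LA] ++ [:: LA]) \/
  (exists a : nat, s = [:: LS; LA] ++ rep a [:: LS; LA] ++ [:: LN]).
Proof.
split=> [[n [B [n0 BT sE]]]|].
- have f1 : epr_entry B 1 = LS.
    by move: hS; rewrite -sE; case: n B {BT sE} n0 => // n B _ [].
  have [[]|[a]] := epr_cases n0 BT f1; rewrite sE.
  + by left.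
  + by right; left.
  + by do 2!right; left.
  + by do 3!right; left.
  case: (odd n) => [|{}sE]; last first.
    (* A single block SA belongs to the form of letters S followed by one A. *)
    case: a sE => [|a] sE; first by right; left; exists 0; rewrite sE.
    by do 4!right; left; exists a; rewrite sE cats0.
  case fn : (epr_entry B n) => {}sE; last 2 first.
  + by case: (epr_entry_full fn).
  + by do 6!right; exists a.
  (* Likewise SAA is the shortest sequence of the form ending in AA. *)
  case: a sE => [|a] sE; first by do 2!right; left; exists 0; rewrite sE.
  by do 5!right; left; exists a.
- case=> [[a [b ->]]|]; first exact: attainable_SN.
  case=> [[a ->]|]; first exact: attainable_SA.
  case=> [[a ->]|]; first exact: attainable_SAA.
  case=> [[a ->]|]; first exact: attainable_SAN.
  case=> [[a ->]|]; first by have := attainable_SASA a false; rewrite cats0.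
  case=> [[a ->]|[a ->]]; first exact: (attainable_SASA a true).
  exact: attainable_SASAN.
Qed.
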